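(* Let $R$ be a ring, $G$ a finite group acting on $R$, $H$ a subgroup of $G$, $n\ge0$ an integer, $M$ an $RH$-module and $N$ an $RG$-module. Then: (1) $\mathrm{nCtd}_{RH}(M)=\mathrm{nCtd}_{RG}(M\uparrow_H^G)$. (2) $\mathrm{nCtd}_{RG}(N)\ge\mathrm{nCtd}_{RH}(N\downarrow_H^G)$, and equality holds when $RG$ is a separable extension over $RH$.
   Context: Rings are associative with identity; modules are unitary and are left modules unless otherwise specified. $G$ acts on $R$ by ring automorphisms: $r\mapsto g(r)$ is a ring automorphism for each $g\in G$, $(g_1g_2)(r)=g_1(g_2(r))$ and $1(r)=r$. The skew group ring $RG$ is the free left $R$-module with basis $G$ and multiplication $(ag)(bh)=a\,g(b)\,gh$ for $a,b\in R$, $g,h\in G$. For a subgroup $H\le G$ (with the restricted action), $RH$ is a subring of $RG$. For an $RH$-module $M$, $M\uparrow_H^G=RG\otimes_{RH}M$ is the induced $RG$-module; for an $RG$-module $N$, $N\downarrow_H^G$ is $N$ viewed as an $RH$-module by restriction of scalars. A ring $A$ is a separable extension over a subring $S$ if the multiplication map $A\otimes_S A\to A$, $a\otimes b\mapsto ab$, splits as a map of $A$-$A$-bimodules; i.e. there is $\sum_i a_i\otimes b_i\in A\otimes_S A$ with $\sum_i a_i\otimes b_i a=\sum_i a a_i\otimes b_i$ for all $a\in A$ and $\sum_i a_ib_i=1$. The left $n$-cotorsion dimension $\mathrm{nCtd}_A(M)$ of an $A$-module $M$ is the smallest integer $k\ge0$ such that $\operatorname{Ext}^{k+1}_A(F,M)=0$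 for every $A$-module $F$ of flat dimension at most $n$ ($\infty$ if no such $k$ exists). *)

(* Defs.v *)
From HB Require Import structures.
From mathcomp Require Import all_boot all_order all_algebra all_fingroup.
From mathcomp Require Import boolp functions constructive_ereal.
From mathcomp Require Import freeg.

Set Implicit Arguments.
Unset Strict Implicit.
Unset Printing Implicit Defensive.

Import Order.TTheory GRing.Theory Num.Theory.
Local Open Scope ring_scope.
Local Open Scope quotient_scope.

(** * Skew group rings *)

(* Bijectivity of each [ract g] follows from the two axioms. *)
Record ring_action (gT : finGroupType) (R : pzRingType) := RingAction {
  ract :> gT -> {rmorphism R -> R};
  ract1 : forall r, ract 1%g r = r;
  ractM : forall g1 g2 r, ract (g1 * g2)%g r = ract g1 (ract g2 r) }.

Section SkewGroupRing.
Variables (gT : finGroupType) (R : pzRingType) (alpha : ring_action gT R).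

(* [u] stands for the sum over [g] of [u g] times the basis element [g]. *)
Definition skew_group_ring & ring_action gT R : Type := {ffun gT -> R}.
Local Notation RG := (skew_group_ring alpha).
HB.instance Definition _ := GRing.Zmodule.on RG.

Definition skew_basis (a : R) (g : gT) : RG := [ffun x => if x == g then a else 0].

Definition skew_one : RG := skew_basis 1 1%g.

Definition skew_mul (u v : RG) : RG :=
  [ffun x => \sum_(g : gT) u g * alpha g (v (g^-1 * x)%g)].

Lemma skew_mulA : associative skew_mul.
Proof.
move=> u v w; apply/ffunP => x; rewrite !ffunE.
under eq_bigr => g _ do rewrite ffunE raddf_sum mulr_sumr.
under [RHS]eq_bigr => h _ do rewrite ffunE mulr_suml.
rewrite [RHS]exchange_big /=; apply: eq_bigr => g _.
rewrite [RHS](reindex_inj (mulgI g)) /=; apply: eq_bigr => h _.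
by rewrite rmorphM mulrA ractM mulKg invMg mulgA.
Qed.

Lemma skew_mul1l : left_id skew_one skew_mul.
Proof.
move=> u; apply/ffunP => x; rewrite ffunE (bigD1 1%g) //= big1 ?addr0.
  by rewrite ffunE eqxx mul1r ract1 invg1 mul1g.
by move=> g gN1; rewrite ffunE (negPf gN1) mul0r.
Qed.

Lemma skew_mul1r : right_id skew_one skew_mul.
Proof.
move=> u; apply/ffunP => x; rewrite ffunE (bigD1 x) //= big1 ?addr0.
  by rewrite ffunE mulVg eqxx rmorph1 mulr1.
move=> g gNx; rewrite ffunE -(inj_eq (mulgI g)) mulKVg mulg1 eq_sym.
by rewrite (negPf gNx) raddf0 mulr0.
Qed.

Lemma skew_mulDl : left_distributive skew_mul +%R.
Proof.
move=> u v w; apply/ffunP => x; rewrite !ffunE -big_split /=.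
by apply: eq_bigr => g _; rewrite ffunE mulrDl.
Qed.

Lemma skew_mulDr : right_distributive skew_mul +%R.
Proof.
move=> u v w; apply/ffunP => x; rewrite !ffunE -big_split /=.
by apply: eq_bigr => g _; rewrite ffunE raddfD mulrDr.
Qed.

HB.instance Definition _ := GRing.Zmodule_isPzRing.Build RG
  skew_mulA skew_mul1l skew_mul1r skew_mulDl skew_mulDr.

Lemma skew_oneE (x : gT) : (1 : RG) x = if x == 1%g then 1 else 0.
Proof. exact: ffunE. Qed.

Lemma skew_mulE (u v : RG) (x : gT) :
  (u * v) x = \sum_(g : gT) u g * alpha g (v (g^-1 * x)%g).
Proof. exact: ffunE. Qed.

Lemma skew_basisM (a b : R) (g h : gT) :
  skew_basis a g * skew_basis b h = skew_basis (a * alpha g b) (g * h)%g.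
Proof.
apply/ffunP => x; rewrite ffunE (bigD1 g) //= big1 ?addr0; last first.
  by move=> k kNg; rewrite ffunE (negPf kNg) mul0r.
rewrite !ffunE eqxx -(inj_eq (mulgI g)) mulKVg.
by case: eqP; rewrite // raddf0 mulr0.
Qed.

End SkewGroupRing.

Section Subgroup.
Variables (gT : finGroupType) (R : pzRingType) (alpha : ring_action gT R).
Variable H : {group gT}.

Program Definition restr_action : ring_action (subg_of H) R :=
  @RingAction _ _ (fun h => alpha (sgval h)) _ _.
Next Obligation. exact: ract1. Qed.
Next Obligation. exact: ractM. Qed.

(* The inclusion of RH into RG. *)
Definition skew_incl (u : skew_group_ring restr_action) : skew_group_ring alpha :=
  [ffun x => if x \in H then u (subg H x) else 0].

Lemma skew_incl_is_additive : {morph skew_incl : u v / u - v}.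
Proof.
move=> u v; apply/ffunP => x; rewrite !ffunE.
by case: ifP; rewrite ?ffunE ?subr0.
Qed.
HB.instance Definition _ :=
  GRing.isZmodMorphism.Build _ _ skew_incl skew_incl_is_additive.

Lemma skew_incl_is_monoid_morphism : monoid_morphism skew_incl.
Proof.
split=> [|u v]; apply/ffunP => x; rewrite ffunE.
  rewrite !skew_oneE; case: ifP => xH.
    by rewrite -(inj_eq val_inj) /= subgK.
  by case: eqP => // x1; rewrite x1 group1 in xH.
rewrite [RHS]skew_mulE; case: ifP => xH; last first.
  rewrite big1 // => g _; rewrite !ffunE; case: ifP => gH; last by rewrite mul0r.
  by rewrite groupMl ?groupV // xH raddf0 mulr0.
rewrite skew_mulE [RHS](bigID (mem H)) /= [X in _ + X]big1 ?addr0; last first.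
  by move=> g gNH; rewrite ffunE (negPf gNH) mul0r.
rewrite (reindex_onto (@sgval _ H) (subg H)) /=; last first.
  by move=> g gH; rewrite subgK.
rewrite /reverse_coercion; apply: eq_big => [h|h _].
  by rewrite subgP sgvalK eqxx.
have hH := subgP h; rewrite !ffunE hH sgvalK groupMl ?groupV // xH.
congr (u h * alpha _ (v _)); apply: val_inj => /=.
by rewrite !subgK // groupMl ?groupV.
Qed.
HB.instance Definition _ :=
  GRing.isMonoidMorphism.Build _ _ skew_incl skew_incl_is_monoid_morphism.

Lemma skew_incl_inj : injective skew_incl.
Proof.
move=> u v /ffunP uv; apply/ffunP => h.
by have := uv (sgval h); rewrite !ffunE subgP sgvalK.
Qed.

End Subgroup.

(** * Tensor products; right A-modules are modules over the converse ring [A^c] *)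

Section TensorDef.
Variables (A : pzRingType) (X : lmodType A^c) (Y : lmodType A).
Local Notation free := {freeg (X * Y)%type / int}.
Local Notation gen x y := (<< 1 *g ((x, y) : X * Y) >> : free).

Inductive tens_relation : free -> Prop :=
| TensRel0 : tens_relation 0
| TensRelB z1 z2 of tens_relation z1 & tens_relation z2 : tens_relation (z1 - z2)
| TensRelDl x x' y : tens_relation (gen (x + x') y - gen x y - gen x' y)
| TensRelDr x y y' : tens_relation (gen x (y + y') - gen x y - gen x y')
| TensRelZ (a : A) x y : tens_relation (gen ((a : A^c) *: x) y - gen x (a *: y)).

Definition tens_rel : {pred free} := fun z => `[< tens_relation z >].

Lemma tens_rel_zmod_closed : zmod_closed tens_rel.
Proof.
split=> [|z1 z2 /asboolP h1 /asboolP h2]; apply/asboolP.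
  exact: TensRel0.
exact: TensRelB.
Qed.
HB.instance Definition _ := GRing.isZmodClosed.Build _ tens_rel tens_rel_zmod_closed.

Definition tensor : Type := Quotient.quot tens_rel.
HB.instance Definition _ := GRing.Zmodule.on tensor.

Definition tens (x : X) (y : Y) : tensor := \pi_tensor (gen x y).

End TensorDef.

Section TensorTheory.
Variables (A : pzRingType) (X : lmodType A^c) (Y : lmodType A).

Lemma tens_rel0 z : tens_relation z -> \pi_(tensor X Y) z = 0.
Proof.
move=> zr; have /eqP : z == 0 %[mod tensor X Y]; last by rewrite raddf0.
by rewrite -Quotient.idealrBE subr0; apply/asboolP.
Qed.

Lemma tensDl (x x' : X) (y : Y) : tens (x + x') y = tens x y + tens x' y.
Proof.
apply/eqP; rewrite -subr_eq0 opprD addrA -!raddfB; apply/eqP/tens_rel0.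
exact: TensRelDl.
Qed.

Lemma tensDr (x : X) (y y' : Y) : tens x (y + y') = tens x y + tens x y'.
Proof.
apply/eqP; rewrite -subr_eq0 opprD addrA -!raddfB; apply/eqP/tens_rel0.
exact: TensRelDr.
Qed.

Lemma tensZ (a : A) (x : X) (y : Y) : tens ((a : A^c) *: x) y = tens x (a *: y).
Proof. by apply/eqP; rewrite -subr_eq0 -!raddfB; apply/eqP/tens_rel0/TensRelZ. Qed.

Lemma tens_ind (P : tensor X Y -> Prop) :
  (forall x y, P (tens x y)) -> (forall t u, P t -> P u -> P (t - u)) ->
  forall t, P t.
Proof.
move=> Pt PB t.
have P0 : P 0 by rewrite -(subrr (tens 0 0)); apply: PB.
have PN u : P u -> P (- u) by move=> Pu; rewrite -sub0r; apply: PB.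
have PD u v : P u -> P v -> P (u + v).
  by move=> Pu Pv; rewrite -[v]opprK; apply: PB => //; apply: PN.
elim/quotW: t => z; rewrite -(freeg_sumE z) raddf_sum /=.
elim/big_ind: _ => // -[x y] _.
rewrite -[coeff _ _]intz -freeg_mulz.
have PM n : P (tens x y *+ n).
  by elim: n => [|n IHn]; rewrite ?mulr0n // mulrS; apply: PD.
by rewrite raddfMz; case: (coeff _ _) => n; last apply: PN; apply: PM.
Qed.

Definition balanced (Z : zmodType) (f : X -> Y -> Z) : Prop :=
  [/\ forall x x' y, f (x + x') y = f x y + f x' y,
      forall x y y', f x (y + y') = f x y + f x y'
    & forall (a : A) x y, f ((a : A^c) *: x) y = f x (a *: y)].

Section Lift.
Variables (Z : zmodType) (f : X -> Y -> Z).

Definition tens_lift & balanced f := fun t : tensor X Y =>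
  fglift (fun p : X * Y => f p.1 p.2 : zmodule Z) (generic_quotient.repr t) : Z.

Hypothesis bf : balanced f.

Lemma tens_lift_pi (z : {freeg (X * Y)%type / int}) :
  tens_lift bf (\pi_(tensor X Y) z) = fglift (fun p : X * Y => f p.1 p.2 : zmodule Z) z.
Proof.
rewrite /tens_lift; set F := fglift _.
have FB : additive F := lift_is_additive _.
have FU u : F << u >> = f u.1 u.2 by rewrite /F liftU scale1r.
apply/eqP; rewrite -subr_eq0 -FB; apply/eqP.
have : generic_quotient.repr (\pi_(tensor X Y) z) - z \in @tens_rel A X Y.
  by rewrite Quotient.idealrBE reprK.
move/asboolP; case: bf => fDl fDr fZ.
elim=> [|z1 z2 _ h1 _ h2|x x' y|x y y'|a x y].
- by have := FB 0 0; rewrite !subrr.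
- by rewrite FB h1 h2 subr0.
- by rewrite !FB !FU /= fDl -addrA -opprD subrr.
- by rewrite !FB !FU /= fDr -addrA -opprD subrr.
- by rewrite !FB !FU /= fZ subrr.
Qed.

Lemma tens_lift_is_additive : {morph tens_lift bf : t u / t - u}.
Proof.
move=> t u; rewrite -[t]reprK -[u]reprK -raddfB !tens_lift_pi.
exact: (lift_is_additive (fun p : X * Y => f p.1 p.2 : zmodule Z)).
Qed.
HB.instance Definition _ :=
  GRing.isZmodMorphism.Build _ _ (tens_lift bf) tens_lift_is_additive.

Lemma tens_liftE x y : tens_lift bf (tens x y) = f x y.
Proof. by rewrite tens_lift_pi liftU /= scale1r. Qed.

End Lift.
End TensorTheory.

Section TensorMap.
Variables (A : pzRingType) (X X' : lmodType A^c) (Y Y' : lmodType A).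
Variables (f : {linear X -> X'}) (g : {linear Y -> Y'}).

Lemma tens_map_balanced : balanced (fun x y => tens (f x) (g y)).
Proof.
by split=> *; rewrite ?raddfD ?tensDl ?tensDr // !linearZ tensZ.
Qed.

Definition tens_map : tensor X Y -> tensor X' Y' := tens_lift tens_map_balanced.
HB.instance Definition _ := GRing.Additive.on tens_map.

Lemma tens_mapE x y : tens_map (tens x y) = tens (f x) (g y).
Proof. exact: tens_liftE. Qed.

End TensorMap.

(** * Change of rings *)

Section ChangeOfRings.
Variables (A B : pzRingType) (phi : {rmorphism A -> B}).

Definition restriction (_ : {rmorphism A -> B}) (N : lmodType B) : Type := N.

Section Restriction.
Variable N : lmodType B.
Local Notation resN := (restriction phi N).
HB.instance Definition _ := GRing.Zmodule.on resN.

Definition res_scale (a : A) (x : resN) : resN := phi a *: (x : N).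

Fact res_scaleA a b x : res_scale a (res_scale b x) = res_scale (a * b) x.
Proof. by rewrite /res_scale scalerA rmorphM. Qed.
Fact res_scale1 : left_id 1 res_scale.
Proof. by move=> x; rewrite /res_scale rmorph1 scale1r. Qed.
Fact res_scaleDr : right_distributive res_scale +%R.
Proof. by move=> a x y; rewrite /res_scale scalerDr. Qed.
Fact res_scaleDl x : {morph res_scale^~ x : a b / a + b}.
Proof. by move=> a b; rewrite /res_scale raddfD scalerDl. Qed.
HB.instance Definition _ := GRing.Zmodule_isLmodule.Build A resN
  res_scaleA res_scale1 res_scaleDr res_scaleDl.
End Restriction.

(* B as a B-A-bimodule: B acts by left multiplication, and A on the right
   through phi. *)
Definition right_ext (_ : {rmorphism A -> B}) : Type := B.
Local Notation BA := (right_ext phi).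
HB.instance Definition _ := GRing.Zmodule.on BA.

Definition right_ext_scale (a : A^c) (b : BA) : BA := (b : B) * phi a.

Fact right_ext_scaleA (a a' : A^c) b :
  right_ext_scale a (right_ext_scale a' b) = right_ext_scale (a * a') b.
Proof. by rewrite /right_ext_scale -mulrA -rmorphM. Qed.
Fact right_ext_scale1 : left_id 1 right_ext_scale.
Proof. by move=> b; rewrite /right_ext_scale rmorph1 mulr1. Qed.
Fact right_ext_scaleDr : right_distributive right_ext_scale +%R.
Proof. by move=> a b c; rewrite /right_ext_scale mulrDl. Qed.
Fact right_ext_scaleDl b : {morph right_ext_scale^~ b : a a' / a + a'}.
Proof. by move=> a a'; rewrite /right_ext_scale raddfD mulrDr. Qed.
HB.instance Definition _ := GRing.Zmodule_isLmodule.Build A^c BA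
  right_ext_scaleA right_ext_scale1 right_ext_scaleDr right_ext_scaleDl.

Definition right_ext_mul (b : B) (x : BA) : BA := b * (x : B).

Fact right_ext_mul_additive b : {morph right_ext_mul b : x y / x - y}.
Proof. exact: mulrBr. Qed.
Fact right_ext_mul_scalable b : scalable (right_ext_mul b).
Proof. by move=> a x; apply: mulrA. Qed.
HB.instance Definition _ b := GRing.isZmodMorphism.Build _ _
  (right_ext_mul b) (right_ext_mul_additive b).
HB.instance Definition _ b := GRing.isScalable.Build _ _ _ _
  (right_ext_mul b) (right_ext_mul_scalable b).

Section Induction.
Variable M : lmodType A.

Definition induction : Type := tensor BA M.
HB.instance Definition _ := GRing.Zmodule.on induction.

Definition ind_scale (b : B) : induction -> induction := tens_map (right_ext_mul b) idfun.

Lemma ind_scaleB b : {morph ind_scale b : t u / t - u}.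
Proof. exact: raddfB. Qed.

Lemma ind_scale_tens b (x : BA) (y : M) :
  ind_scale b (tens x y) = tens (b * x : BA) y.
Proof. exact: tens_mapE. Qed.

Fact ind_scaleA b c t : ind_scale b (ind_scale c t) = ind_scale (b * c) t.
Proof.
elim/tens_ind: t => [x y|t u ht hu]; last by rewrite !ind_scaleB ht hu.
by rewrite !ind_scale_tens mulrA.
Qed.
Fact ind_scale1 : left_id 1 ind_scale.
Proof.
elim/tens_ind => [x y|t u ht hu]; last by rewrite ind_scaleB ht hu.
by rewrite ind_scale_tens mul1r.
Qed.
Fact ind_scaleDr : right_distributive ind_scale +%R.
Proof. by move=> b t u; apply: raddfD. Qed.
Fact ind_scaleDl t : {morph ind_scale^~ t : b c / b + c}.
Proof.
move=> b c; elim/tens_ind: t => [x y|t u ht hu].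
  by rewrite !ind_scale_tens mulrDl tensDl.
by rewrite !ind_scaleB ht hu opprD addrACA.
Qed.
HB.instance Definition _ := GRing.Zmodule_isLmodule.Build B induction
  ind_scaleA ind_scale1 ind_scaleDr ind_scaleDl.
End Induction.

End ChangeOfRings.

Section Separable.
Variables (A B : pzRingType) (phi : {rmorphism A -> B}).
Local Notation BA := (right_ext phi).
Local Notation AB := (restriction phi B^o).

(* B (x)_A B, with its structure of left B-module *)
Definition tensor_square := induction phi AB.
HB.instance Definition _ := GRing.Lmodule.on tensor_square.

Definition square_rmul_fun (b : B) (y : AB) : AB := (y : B) * b.
Fact square_rmul_fun_additive b : {morph square_rmul_fun b : x y / x - y}.
Proof. by move=> x y; apply: mulrBl. Qed.
Fact square_rmul_fun_scalable b : scalable (square_rmul_fun b).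
Proof. by move=> a x; apply/esym/mulrA. Qed.
HB.instance Definition _ b := GRing.isZmodMorphism.Build _ _
  (square_rmul_fun b) (square_rmul_fun_additive b).
HB.instance Definition _ b := GRing.isScalable.Build _ _ _ _
  (square_rmul_fun b) (square_rmul_fun_scalable b).

Definition square_rmul (t : tensor_square) (b : B) : tensor_square :=
  tens_map (idfun : BA -> BA) (square_rmul_fun b) t.

Fact square_mult_balanced : balanced (fun (x : BA) (y : AB) => (x : B) * (y : B)).
Proof.
split=> [x x' y|x y y'|a x y]; first exact: mulrDl; first exact: mulrDr.
by apply/esym/mulrA.
Qed.

Definition square_mult : tensor_square -> B := tens_lift square_mult_balanced.

(* B is a separable extension of (the image of) A: square_mult has a section
   which is a morphism of B-B-bimodules. *)
Definition separable_extension : Prop :=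
  exists sigma : {additive B -> tensor_square},
    [/\ forall b x : B, sigma (b * x) = b *: sigma x,
        forall b x : B, sigma (x * b) = square_rmul (sigma x) b
      & forall x : B, square_mult (sigma x) = x].

End Separable.

(** * Homological algebra *)

Section Homological.
Variable A : pzRingType.

Definition projective (P : lmodType A) : Prop :=
  forall (X Y : lmodType A) (p : {linear X -> Y}) (f : {linear P -> Y}),
    (forall y, exists x, p x = y) ->
    exists g : {linear P -> X}, forall x, p (g x) = f x.

Definition flat (F : lmodType A) : Prop :=
  forall (X X' : lmodType A^c) (i : {linear X -> X'}),
    injective i -> injective (tens_map i (idfun : F -> F)).

(* exact complexes ... -> obj 1 -> obj 0 -> F -> 0 *)
Record resolution (F : lmodType A) := Resolution {
  res_obj :> nat -> lmodType A;
  res_d : forall k, {linear res_obj k.+1 -> res_obj k};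
  res_aug : {linear res_obj 0%N -> F};
  res_aug_surj : forall y, exists x, res_aug x = y;
  res_exact0 : forall x, res_aug x = 0 <-> exists y, res_d 0 y = x;
  res_exactS : forall k x, res_d k x = 0 <-> exists y, res_d k.+1 y = x }.

Definition flat_dim_le (n : nat) (F : lmodType A) : Prop :=
  exists P : resolution F,
    (forall k, flat (P k)) /\ (forall k, (n < k)%N -> forall x : P k, x = 0).

Section Ext.
Variables (F : lmodType A) (P : resolution F) (M : lmodType A) (k : nat).

(* Ext P M k is the k-th cohomology group of the complex Hom_A(P, M). *)
Definition is_cocycle (f : P k -> M) : Prop :=
  linear f /\ forall x, f (res_d P k x) = 0.

Definition is_coboundary : (P k -> M) -> Prop :=
  match k return (P k -> M) -> Prop with
  | 0 => fun f => forall x, f x = 0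
  | j.+1 => fun f => exists g : {linear P j -> M}, forall x, f x = g (res_d P j x)
  end.

Fact is_coboundary0 : is_coboundary 0.
Proof. by rewrite /is_coboundary; case: k => [//|j]; exists \0%R. Qed.

Fact is_coboundaryB f g :
  is_coboundary f -> is_coboundary g -> is_coboundary (f - g).
Proof.
rewrite /is_coboundary; case: k f g => [|j] f g.
  by move=> f0 g0 x; rewrite !fctE f0 g0 subr0.
by move=> [u fE] [v gE]; exists (u \- v) => x; rewrite !fctE fE gE.
Qed.

Definition cocycles : {pred P k -> M} := fun f => `[< is_cocycle f >].

Fact cocycles_zmod_closed : zmod_closed cocycles.
Proof.
split=> [|f g /asboolP[fl f0] /asboolP[gl g0]]; apply/asboolP; split.
- by move=> a x y; change (0 = a *: 0 + 0 :> M); rewrite scaler0 addr0.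
- by [].
- by move=> a x y; rewrite !fctE fl gl scalerBr opprD addrACA.
- by move=> x; rewrite !fctE f0 g0 subr0.
Qed.
HB.instance Definition _ := GRing.isZmodClosed.Build _ cocycles cocycles_zmod_closed.

Definition cocycle := {f : P k -> M | f \in cocycles}.
HB.instance Definition _ := SubChoice.on cocycle.
HB.instance Definition _ := [SubChoice_isSubZmodule of cocycle by <:].

Definition coboundaries : {pred cocycle} := fun f => `[< is_coboundary (val f) >].
Fact coboundaries_zmod_closed : zmod_closed coboundaries.
Proof.
split=> [|f g /asboolP hf /asboolP hg]; apply/asboolP.
  by rewrite raddf0; apply: is_coboundary0.
by rewrite raddfB; apply: is_coboundaryB.
Qed.
HB.instance Definition _ :=
  GRing.isZmodClosed.Build _ coboundaries coboundaries_zmod_closed.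

Definition Ext : Type := Quotient.quot coboundaries.
HB.instance Definition _ := GRing.Zmodule.on Ext.

End Ext.

(* The choice of the projective resolution P does not matter, as Ext P M k is
   independent of it up to isomorphism; one exists by
   projective_resolution_exists below. *)
Definition Ext_eq0 (k : nat) (F M : lmodType A) : Prop :=
  forall P : resolution F, (forall j, projective (P j)) ->
    forall x : Ext P M k, x = 0.

Definition cotorsion_bound (n : nat) (M : lmodType A) (k : nat) : Prop :=
  forall F : lmodType A, flat_dim_le n F -> Ext_eq0 k.+1 F M.

Definition nCtd (n : nat) (M : lmodType A) : \bar int :=
  if pselect (exists k, `[< cotorsion_bound n M k >]) is left exk
  then ((ex_minn exk)%:Z)%:E else +oo%E.

End Homological.

Section EnoughProjectives.
Variable A : pzRingType.
Local Notation Zto := (intr : {rmorphism int -> A}).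

Section Free.
Variables (K : choiceType).
Local Notation free := (induction Zto {freeg K / int}).

Section Lift.
Variables (X : lmodType A) (h : K -> X).
Local Notation lifth := (fglift (h : K -> zmodule X)).

Fact lifthB : {morph (lifth : {freeg K / int} -> X) : z w / z - w}.
Proof. exact: (lift_is_additive (h : K -> zmodule X)). Qed.
HB.instance Definition _ :=
  GRing.isZmodMorphism.Build {freeg K / int} X (lifth : _ -> X) lifthB.

Fact free_lift_balanced :
  balanced (fun (a : right_ext Zto) (z : {freeg K / int}) => (a : A) *: (lifth z : X)).
Proof.
split=> [a b z|a z w|m a z].
- exact: scalerDl.
- by rewrite -scalerDr; congr (_ *: _); apply: (raddfD (lifth : {freeg K / int} -> X)).
- rewrite -[m in m *: z]intz scaler_int.
  rewrite (raddfMz (lifth : {freeg K / int} -> X)).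
  by rewrite -scaler_int scalerA.
Qed.

Definition free_lift : free -> X := tens_lift free_lift_balanced.

Fact free_lift_additive : {morph free_lift : t u / t - u}.
Proof. exact: raddfB. Qed.
HB.instance Definition _ := GRing.isZmodMorphism.Build _ _ free_lift free_lift_additive.

Fact free_lift_scalable : scalable free_lift.
Proof.
move=> a; apply: tens_ind => [b z|t u ht hu].
  rewrite [_ *: _]ind_scale_tens /free_lift !tens_liftE.
  by rewrite scalerA.
rewrite -[t - u]/((t : free) - (u : free)).
by rewrite scalerBr !free_lift_additive ht hu scalerBr.
Qed.
HB.instance Definition _ := GRing.isScalable.Build _ _ _ _ free_lift free_lift_scalable.

Definition free_gen (k : K) : free := tens (1 : right_ext Zto) << k >>.

Lemma free_liftE k : free_lift (free_gen k) = h k.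
Proof. by rewrite /free_lift tens_liftE scale1r liftU scale1r. Qed.
End Lift.

Lemma free_eq (X : lmodType A) (f g : {linear free -> X}) :
  (forall k, f (free_gen k) = g (free_gen k)) -> f =1 g.
Proof.
move=> fg.
have fgB t u : f t = g t -> f u = g u -> f (t - u) = g (t - u).
  by move=> ht hu; rewrite 2!linearB ht hu.
apply: tens_ind => [a z|t u]; last exact: fgB.
have -> : tens a z = (a : A) *: (tens (1 : right_ext Zto) z : free).
  by rewrite [RHS]ind_scale_tens mulr1.
rewrite 2!linearZ; congr (_ *: _).
pose tz (w : {freeg K / int}) : free := tens (1 : right_ext Zto) w.
have tzB : {morph tz : v w / v - w}.
  move=> v w; apply/eqP; rewrite eq_sym subr_eq; apply/eqP.
  by rewrite -[LHS]/(tz v) -[v in LHS](subrK w); apply: tensDr.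
have fzB : {morph f \o tz : v w / v - w} by move=> v w /=; rewrite tzB linearB.
have gzB : {morph g \o tz : v w / v - w} by move=> v w /=; rewrite tzB linearB.
pose fz : {additive {freeg K / int} -> X} :=
  HB.pack (f \o tz) (GRing.isZmodMorphism.Build _ _ (f \o tz) fzB).
pose gz : {additive {freeg K / int} -> X} :=
  HB.pack (g \o tz) (GRing.isZmodMorphism.Build _ _ (g \o tz) gzB).
rewrite -[LHS]/(fz z) -[RHS]/(gz z) -(freeg_sumE z) 2!raddf_sum.
apply: eq_bigr => k _; rewrite -[coeff _ _]intz -freeg_mulz 2!raddfMz.
by congr (_ *~ _); apply: fg.
Qed.

Lemma free_projective : projective free.
Proof.
move=> X Y p f p_surj.
have [s sE] := boolp.choice (fun k : K => p_surj (f (free_gen k))).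
pose L : {linear free -> X} := free_lift s.
exists L; apply: (@free_eq _ (p \o L)) => k; rewrite -sE.
by congr (p _); apply: free_liftE.
Qed.
End Free.

Lemma enough_projectives (Y : lmodType A) :
  {P : lmodType A & {p : {linear P -> Y} | projective P /\ forall y, exists x, p x = y}}.
Proof.
pose L : {linear induction Zto {freeg Y / int} -> Y} := free_lift (idfun : Y -> Y).
exists (induction Zto {freeg Y / int}), L.
by split; [exact: free_projective | move=> y; exists (free_gen y); apply: free_liftE].
Qed.

Section Kernel.
Variables (X Y : lmodType A) (d : {linear X -> Y}).
Definition ker : {pred X} := fun x => d x == 0.
Fact ker_submod_closed : submod_closed ker.
Proof.
split=> [|a x y /eqP dx /eqP dy]; first by apply/eqP; rewrite raddf0.
by apply/eqP; rewrite linearP dx dy scaler0 addr0.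
Qed.
HB.instance Definition _ := GRing.isSubmodClosed.Build A X ker ker_submod_closed.
Definition kernel := {x : X | x \in ker}.
HB.instance Definition _ := SubChoice.on kernel.
HB.instance Definition _ := [SubChoice_isSubLmodule of kernel by <:].
End Kernel.

Record stage := Stage { src : lmodType A; tgt : lmodType A; arrow : {linear src -> tgt} }.

Definition next_stage (s : stage) : stage :=
  Stage ((val : kernel (arrow s) -> src s) \o
    projT1 (projT2 (enough_projectives (kernel (arrow s))))).

Lemma next_stage_exact (s : stage) (x : src s) :
  arrow s x = 0 <-> exists y, arrow (next_stage s) y = x.
Proof.
rewrite /next_stage; case: enough_projectives => P [p [_ p_surj]] /=.
split=> [sx0 | [y <-]]; last exact/eqP/(valP (p y)).
have kx : x \in ker (arrow s) by apply/eqP.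
have [y py] := p_surj (Sub x kx).
by exists y; rewrite /= py SubK.
Qed.

Lemma next_stage_projective (s : stage) : projective (src (next_stage s)).
Proof. by rewrite /next_stage /=; case: enough_projectives => P [p []]. Qed.

Lemma projective_resolution_exists (F : lmodType A) :
  exists P : resolution F, forall j, projective (P j).
Proof.
have [P0 [p [P0_proj p_surj]]] := enough_projectives F.
pose s k := iter k next_stage (Stage p).
exists (@Resolution A F (fun k => src (s k)) (fun k => arrow (s k.+1)) p p_surj
  (@next_stage_exact (s 0%N)) (fun k => @next_stage_exact (s k.+1))).
by case=> [//|j]; apply: next_stage_projective.
Qed.

End EnoughProjectives.

(* Main.v *)
(* RG is a Frobenius extension of RH: the projection of RG onto RH is a bimodule
   map pi, and for representatives t of the left cosets of H the families (t)
   and (t^-1) are dual bases. So induction is both a left and a right adjoint of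
   restriction, both functors are exact, and both preserve projectives, flats
   and hence flat dimension bounds. The two adjunctions then give
   Ext_RG(F^G, N) = Ext_RH(F, N_H) and Ext_RG(F, M^G) = Ext_RH(F_H, M), so that
   cotorsion bounds pass from N to N_H and from M to M^G. Conversely M is a
   direct summand of (M^G)_H since pi splits the inclusion, and N is a direct
   summand of (N_H)^G when the extension is separable. *)
Require Import Defs.
From HB Require Import structures.
From mathcomp Require Import all_boot all_order all_algebra all_fingroup.
From mathcomp Require Import boolp constructive_ereal.

Set Implicit Arguments.
Unset Strict Implicit.
Unset Printing Implicit Defensive.

Import Order.TTheory GRing.Theory Num.Theory.
Local Open Scope ring_scope.
Local Open Scope quotient_scope.

(** * Linear maps and maps out of tensor products *)

Definition linear_of (A : pzRingType) (X Y : lmodType A) (f : X -> Y)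
    (fl : linear f) : {linear X -> Y} :=
  HB.pack f (GRing.isLinear.Build A X Y *:%R f fl).

Lemma tens_ext (A : pzRingType) (X : lmodType A^c) (Y : lmodType A)
    (Z : zmodType) (f g : {additive tensor X Y -> Z}) :
  (forall x y, f (tens x y) = g (tens x y)) -> f =1 g.
Proof.
move=> fg; elim/tens_ind => [x y|t u ht hu]; first exact: fg.
by rewrite 2!raddfB ht hu.
Qed.

Lemma tens0l (A : pzRingType) (X : lmodType A^c) (Y : lmodType A) (y : Y) :
  tens (0 : X) y = 0.
Proof. by apply: (addrI (tens 0 y)); rewrite -tensDl !addr0. Qed.

Lemma tens0r (A : pzRingType) (X : lmodType A^c) (Y : lmodType A) (x : X) :
  tens x (0 : Y) = 0.
Proof. by apply: (addrI (tens x 0)); rewrite -tensDr !addr0. Qed.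

Lemma tensBr (A : pzRingType) (X : lmodType A^c) (Y : lmodType A) (x : X) :
  {morph (tens x : Y -> _) : y y' / y - y'}.
Proof.
move=> y y'; apply/eqP; rewrite eq_sym subr_eq; apply/eqP.
by rewrite -tensDr subrK.
Qed.

Lemma tens_suml (A : pzRingType) (X : lmodType A^c) (Y : lmodType A)
    (I : finType) (P : pred I) (x : I -> X) (y : Y) :
  tens (\sum_(i | P i) x i) y = \sum_(i | P i) tens (x i) y.
Proof.
apply: (big_morph (fun x => tens x y)) => [u v|]; first exact: tensDl.
exact: tens0l.
Qed.

Lemma tens_sumr (A : pzRingType) (X : lmodType A^c) (Y : lmodType A)
    (I : finType) (P : pred I) (x : X) (y : I -> Y) :
  tens x (\sum_(i | P i) y i) = \sum_(i | P i) tens x (y i).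
Proof.
apply: (big_morph (tens x)) => [u v|]; first exact: tensDr.
exact: tens0r.
Qed.

(** * Induction and restriction as functors, with induction on the left *)

Section Adjunction.
Variables (S A : pzRingType) (phi : {rmorphism S -> A}).

(** Pure tensors generate the induced module as a group. This is [tens_ext] restated for the
    additive structure carried by [induction], so that module maps can be compared through it. *)
Lemma ind_ext (M : lmodType S) (Z : zmodType)
    (f g : {additive induction phi M -> Z}) :
  (forall (a : A) x, f (tens (a : right_ext phi) x) = g (tens (a : right_ext phi) x)) ->
  f =1 g.
Proof. exact: (@tens_ext _ _ _ _ (f : {additive tensor _ _ -> Z}) g). Qed.

Section IndMap.
Variables (M M' : lmodType S) (f : {linear M -> M'}).

Definition ind_map_fun : induction phi M -> induction phi M' :=
  tens_map (idfun : right_ext phi -> right_ext phi) f.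
HB.instance Definition _ := GRing.Additive.on ind_map_fun.

Lemma ind_map_funE (a : right_ext phi) x : ind_map_fun (tens a x) = tens a (f x).
Proof. exact: tens_mapE. Qed.

Fact ind_map_scalable : scalable ind_map_fun.
Proof.
move=> a t; move: t; apply: (@ind_ext M _ (ind_map_fun \o *:%R a) ( *:%R a \o ind_map_fun)).
move=> b x /=; rewrite [a *: _]ind_scale_tens !ind_map_funE.
exact/esym/ind_scale_tens.
Qed.
HB.instance Definition _ := GRing.isScalable.Build _ _ _ _ ind_map_fun ind_map_scalable.
Definition ind_map : {linear induction phi M -> induction phi M'} := ind_map_fun.

Lemma ind_mapE (a : right_ext phi) x : ind_map (tens a x) = tens a (f x).
Proof. exact: ind_map_funE. Qed.
End IndMap.

Section ResMap.
Variables (N N' : lmodType A) (f : {linear N -> N'}).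
Fact res_map_linear : linear (f : restriction phi N -> restriction phi N').
Proof. by move=> a x y; apply: linearP. Qed.
Definition res_map : {linear restriction phi N -> restriction phi N'} :=
  linear_of res_map_linear.
End ResMap.

Section IndLift.
Variables (M : lmodType S) (N : lmodType A) (h : {linear M -> restriction phi N}).

Fact ind_lift_balanced :
  balanced (fun (a : right_ext phi) (x : M) => (a : A) *: (h x : N)).
Proof.
split=> [a b x|a x y|s a x].
- exact: scalerDl.
- by rewrite linearD; apply: scalerDr.
- by rewrite linearZ; apply/esym/scalerA.
Qed.

Definition ind_lift_fun : induction phi M -> N := tens_lift ind_lift_balanced.
HB.instance Definition _ := GRing.Additive.on ind_lift_fun.

Lemma ind_lift_funE (a : A) x :
  ind_lift_fun (tens (a : right_ext phi) x) = a *: (h x : N).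
Proof. exact: tens_liftE. Qed.

Fact ind_lift_scalable : scalable ind_lift_fun.
Proof.
move=> a t; move: t; apply: (@ind_ext M _ (ind_lift_fun \o *:%R a) ( *:%R a \o ind_lift_fun)).
by move=> b x /=; rewrite [a *: _]ind_scale_tens !ind_lift_funE scalerA.
Qed.
HB.instance Definition _ := GRing.isScalable.Build _ _ _ _ ind_lift_fun ind_lift_scalable.
(** Transpose of [h] under the adjunction that makes induction left adjoint to restriction;
    [ind_unit] below is its unit. *)
Definition ind_lift : {linear induction phi M -> N} := ind_lift_fun.

Lemma ind_liftE (a : A) x :
  ind_lift (tens (a : right_ext phi) x) = a *: (h x : N).
Proof. exact: ind_lift_funE. Qed.
End IndLift.

Section Unit.
Variable M : lmodType S.
Definition ind_unit_fun (x : M) : restriction phi (induction phi M) :=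
  tens (1 : right_ext phi) x.
Fact ind_unit_linear : linear ind_unit_fun.
Proof.
move=> a x y; rewrite [LHS]tensDr; congr (_ + _).
rewrite /ind_unit_fun -tensZ; apply/esym/(etrans (ind_scale_tens _ _ _)).
by congr tens; rewrite [RHS]mul1r mulr1.
Qed.
Definition ind_unit : {linear M -> restriction phi (induction phi M)} :=
  linear_of ind_unit_linear.
End Unit.

End Adjunction.

Arguments ind_map : simpl never.
Arguments ind_lift : simpl never.

(* [fx] and [fy] are dual bases of A over S with respect to [fpi], so that
   [\sum_i fx i (x) fy i] in A (x)_S A commutes with every element of A. *)
Record frobenius_system (S A : pzRingType) (phi : {rmorphism S -> A}) :=
  FrobeniusSystem {
    fpi : {additive A -> S};
    fpiZl : forall s a, fpi (phi s * a) = s * fpi a;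
    fpiZr : forall a s, fpi (a * phi s) = fpi a * s;
    fidx : finType;
    fx : fidx -> A;
    fy : fidx -> A;
    fsum_r : forall a, \sum_i fx i * phi (fpi (fy i * a)) = a;
    fsum_l : forall a, \sum_i phi (fpi (a * fx i)) * fy i = a }.

(** * Frobenius systems over converse rings *)

Section Opposite.
Variables (S A : pzRingType) (phi : {rmorphism S -> A}).

Definition conv_fun (s : S^c) : A^c := phi s.
Fact conv_zmod_morphism : {morph conv_fun : s t / s - t}.
Proof. exact: (raddfB phi). Qed.
Fact conv_monoid_morphism : monoid_morphism conv_fun.
Proof. by split=> [|s t]; [apply: (rmorph1 phi) | apply: (rmorphM phi)]. Qed.
HB.instance Definition _ :=
  GRing.isZmodMorphism.Build _ _ conv_fun conv_zmod_morphism.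
HB.instance Definition _ :=
  GRing.isMonoidMorphism.Build _ _ conv_fun conv_monoid_morphism.
Definition conv_rmorphism : {rmorphism S^c -> A^c} := conv_fun.

(** The notion is left-right symmetric: passing to converse rings swaps the two dual bases, the two
    linearity laws and the two expansion identities. It carries results on left modules over to
    right modules. *)
Definition conv_frobenius (fs : frobenius_system phi) :
  frobenius_system conv_rmorphism :=
  @FrobeniusSystem S^c A^c conv_rmorphism (fpi fs : {additive A -> S})
    (fun s a => fpiZr fs a s) (fun a s => fpiZl fs s a)
    (fidx fs) (@fy _ _ _ fs) (@fx _ _ _ fs) (fsum_l fs) (fsum_r fs).
End Opposite.

(** * Induction as right adjoint of restriction; exactness, projectivity and flatness *)

Section Frobenius.
Variables (S A : pzRingType) (phi : {rmorphism S -> A}) (fs : frobenius_system phi).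
Local Notation x_ := (@fx _ _ _ fs).
Local Notation y_ := (@fy _ _ _ fs).
Local Notation pi := (fpi fs).

Section IndProj.
Variable M : lmodType S.

Fact ind_proj_balanced :
  balanced (fun (a : right_ext phi) (x : M) => pi (a : A) *: x).
Proof.
split=> [a b x|a x y|s a x].
- by rewrite raddfD scalerDl.
- exact: scalerDr.
- by rewrite scalerA -fpiZr.
Qed.

Definition ind_proj_fun : restriction phi (induction phi M) -> M :=
  tens_lift ind_proj_balanced.

Lemma ind_proj_funE (a : A) x :
  ind_proj_fun (tens (a : right_ext phi) x) = pi a *: x.
Proof. exact: tens_liftE. Qed.

Fact ind_proj_additive : {morph ind_proj_fun : t u / t - u}.
Proof. exact: (raddfB (tens_lift ind_proj_balanced)). Qed.
HB.instance Definition _ := GRing.isZmodMorphism.Build _ _ ind_proj_fun ind_proj_additive.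

Fact ind_proj_scalable : scalable ind_proj_fun.
Proof.
move=> s t; elim/tens_ind: t => [a x|t u ht hu].
  rewrite [s *: _](_ : _ = tens (phi s * a : right_ext phi) x); last first.
    exact: ind_scale_tens.
  by rewrite !ind_proj_funE fpiZl scalerA.
rewrite -[t - u]/((t : restriction phi (induction phi M)) - u).
by rewrite scalerBr !ind_proj_additive ht hu scalerBr.
Qed.
HB.instance Definition _ := GRing.isScalable.Build _ _ _ _ ind_proj_fun ind_proj_scalable.
(** Counit of the adjunction in which induction is right adjoint to restriction. *)
Definition ind_proj : {linear restriction phi (induction phi M) -> M} := ind_proj_fun.

Lemma ind_projE (a : A) x : ind_proj (tens (a : right_ext phi) x) = pi a *: x.
Proof. exact: ind_proj_funE. Qed.
End IndProj.

Section IndColift.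
Variables (N : lmodType A) (M : lmodType S) (h : {linear restriction phi N -> M}).

(** Transpose of [h] under the right adjunction, written with the dual bases. *)
Definition ind_colift_fun (v : N) : induction phi M :=
  \sum_i tens (x_ i : right_ext phi) (h (y_ i *: v)).

Fact ind_colift_linear : linear ind_colift_fun.
Proof.
move=> a v w; rewrite /ind_colift_fun scaler_sumr.
transitivity (\sum_i (tens (x_ i : right_ext phi) (h (y_ i *: (a *: v))) +
                      tens (x_ i : right_ext phi) (h (y_ i *: w)) : induction phi M)).
  apply: eq_bigr => i _; rewrite -[RHS]tensDr -linearD; congr (tens _ (h _)).
  exact: (scalerDr (y_ i) (a *: v) w).
rewrite big_split; congr (_ + _).
(* The element $\sum_i x_i \otimes y_i$ commutes with [a]: [fsum_l] expands [y_ i * a], the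
   coefficients cross the tensor sign, and [fsum_r] reassembles [a * x_ j]. *)
transitivity (\sum_i \sum_j (tens (x_ i : right_ext phi)
                 (pi (y_ i * a * x_ j) *: h (y_ j *: v)) : induction phi M)).
  apply: eq_bigr => i _; rewrite -[RHS]tens_sumr; congr tens.
  rewrite scalerA -[y_ i * a in LHS](fsum_l fs) scaler_suml.
  rewrite (raddf_sum h); apply: eq_bigr => j _.
  by rewrite -linearZ; congr (h _); exact: (esym (scalerA (phi _) (y_ j) v)).
rewrite exchange_big; apply: eq_bigr => j _.
rewrite [RHS]ind_scale_tens -[a * x_ j](fsum_r fs) tens_suml.
by apply: eq_bigr => i _; rewrite -tensZ mulrA.
Qed.
Definition ind_colift : {linear N -> induction phi M} := linear_of ind_colift_linear.
End IndColift.

Arguments ind_proj : simpl never.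

(** On pure tensors this is [fsum_r]. It makes the elements [ind_proj M (y_ i *: v)] of [M]
    coordinates that determine [v]. *)
Lemma ind_sum (M : lmodType S) (v : induction phi M) :
  \sum_i tens (x_ i : right_ext phi) (ind_proj M (y_ i *: v)) = v.
Proof.
move: v; apply: (@ind_ext _ _ _ _ _ (ind_colift (ind_proj M)) idfun) => a m.
rewrite -[RHS]/(tens _ _) -[in RHS](fsum_r fs a) tens_suml; apply: eq_bigr => i _.
by rewrite [_ *: _]ind_scale_tens ind_projE -tensZ.
Qed.

Lemma ind_proj_map (M M' : lmodType S) (f : {linear M -> M'}) v :
  ind_proj M' (ind_map phi f v) = f (ind_proj M v).
Proof.
move: v; apply: (@ind_ext _ _ _ _ _ (ind_proj M' \o ind_map phi f) (f \o ind_proj M)).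
by move=> a m /=; rewrite ind_mapE !ind_projE linearZ.
Qed.

(** By [ind_sum] each coordinate can be lifted separately. The same coordinatewise argument, with
    [ind_proj_map], gives [ind_map_exact] and [ind_map_inj]. *)
Lemma ind_map_surj (M M' : lmodType S) (f : {linear M -> M'}) :
  (forall y, exists x, f x = y) -> forall v, exists u, ind_map phi f u = v.
Proof.
move=> f_surj v.
have [g gE] := boolp.choice (fun i => f_surj (ind_proj M' (y_ i *: v))).
exists (\sum_i tens (x_ i : right_ext phi) (g i)).
rewrite linear_sum -[RHS]ind_sum; apply: eq_bigr => i _.
by rewrite ind_mapE gE.
Qed.

Lemma ind_map_exact (X Y Z : lmodType S) (f : {linear X -> Y}) (g : {linear Y -> Z}) :
  (forall y, g y = 0 <-> exists x, f x = y) ->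
  forall v, ind_map phi g v = 0 <-> exists u, ind_map phi f u = v.
Proof.
move=> fg v; split=> [gv0|[u <-]].
  have /boolp.choice[w wE] i : exists x, f x = ind_proj Y (y_ i *: v).
    by apply/fg; rewrite -ind_proj_map linearZZ gv0 scaler0 linear0.
  exists (\sum_i tens (x_ i : right_ext phi) (w i)).
  rewrite linear_sum -[RHS]ind_sum; apply: eq_bigr => i _.
  by rewrite ind_mapE wE.
move: u; apply: (@ind_ext _ _ _ _ _ (ind_map phi g \o ind_map phi f) \0) => a x /=.
rewrite !ind_mapE (_ : g (f x) = 0); last by apply/fg; exists x.
exact: tens0r.
Qed.

Lemma ind_map_inj (M M' : lmodType S) (f : {linear M -> M'}) :
  injective f -> injective (ind_map phi f).
Proof.
move=> f_inj u v fuv; rewrite -[u]ind_sum -[v]ind_sum; apply: eq_bigr => i _.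
congr tens; apply: f_inj; rewrite -!ind_proj_map; congr (ind_proj _ _).
by rewrite 2!linearZ fuv.
Qed.

(** A left adjoint of a functor preserving surjections preserves projectives: lift the transpose of
    [f] through the restricted [p], then transpose back. *)
Lemma ind_projective (P : lmodType S) : projective P -> projective (induction phi P).
Proof.
move=> P_proj X Y p f p_surj.
pose h := linear_of (linearP (res_map phi f \o ind_unit phi P)).
have [g gE] := P_proj _ _ (res_map phi p) h p_surj.
exists (ind_lift g); apply: (@ind_ext _ _ _ _ _ (p \o ind_lift g) f) => a x /=.
rewrite ind_liftE linearZ; have {}gE : p (g x) = f (ind_unit phi P x) := gE x.
rewrite gE -linearZ; congr (f _).
by apply: etrans (ind_scale_tens _ _ _) _; rewrite mulr1.
Qed.

(** Restriction is left adjoint to induction, and induction preserves surjections by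
    [ind_map_surj]. *)
Lemma res_projective (P : lmodType A) : projective P -> projective (restriction phi P).
Proof.
move=> P_proj X Y p f p_surj.
have [g gE] := P_proj _ _ (ind_map phi p) (ind_colift f) (ind_map_surj p_surj).
exists (linear_of (linearP (ind_proj X \o res_map phi g))) => x.
have -> : linear_of (linearP (ind_proj X \o res_map phi g)) x = ind_proj X (g x) by [].
rewrite -ind_proj_map gE.
rewrite -[ind_colift f x]/(\sum_i _) linear_sum.
(* Triangle identity for the right adjunction: the counit applied to [ind_colift f x] returns [f x],
   because [fsum_l] at [1] gives $\sum_i \phi(\pi(x_i)) y_i = 1$. *)
transitivity (f (\sum_i (phi (pi (x_ i)) * y_ i) *: (x : P) : restriction phi P)).
  rewrite (raddf_sum f); apply: eq_bigr => i _.
  rewrite ind_projE -linearZ; congr (f _); exact: (scalerA (phi _) (y_ i) x).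
congr (f _); rewrite -[RHS](scale1r (x : P)).
apply: etrans (esym (scaler_suml (x : P) _ _ (fun i => phi (pi (x_ i)) * y_ i))) _.
suff -> : \sum_i phi (pi (x_ i)) * y_ i = 1 by [].
by rewrite -[RHS](fsum_l fs); apply: eq_bigr => i _; rewrite mul1r.
Qed.

Section IndFlat.
Variables (F : lmodType S) (X : lmodType A^c).
Local Notation resX := (restriction (conv_rmorphism phi) X).

Section Fixed.
Variable x : X.
Fact ind_assoc_balanced :
  balanced (fun (a : right_ext phi) (z : F) =>
    tens (((a : A) : A^c) *: x : resX) z : tensor resX F).
Proof.
split=> [a b z|a z w|s a z].
- by rewrite -tensDl; congr tens; exact: (scalerDl x (a : A^c) b).
- exact: tensDr.
- by rewrite -tensZ; congr tens; apply/esym/(scalerA (phi s : A^c)).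
Qed.
Definition ind_assoc1 : induction phi F -> tensor resX F := tens_lift ind_assoc_balanced.
HB.instance Definition _ := GRing.Additive.on ind_assoc1.
Lemma ind_assoc1E (a : right_ext phi) z :
  ind_assoc1 (tens a z) = tens (((a : A) : A^c) *: x : resX) z.
Proof. exact: tens_liftE. Qed.
End Fixed.

Fact ind_assoc2_balanced : balanced ind_assoc1.
Proof.
split=> [x y t|x t u|a x t].
- pose f : {additive induction phi F -> tensor resX F} := ind_assoc1 x \+ ind_assoc1 y.
  move: t; apply: (@ind_ext _ _ _ _ _ (ind_assoc1 (x + y)) f) => a z.
  rewrite -[f _]/(ind_assoc1 x _ + ind_assoc1 y _) !ind_assoc1E -tensDl.
  apply: etrans (ind_assoc1E _ _ _) _;  congr tens; exact: (scalerDr (a : A^c) x y).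
- exact: raddfD.
- move: t; apply: (@ind_ext _ _ _ _ _ (ind_assoc1 _) (ind_assoc1 x \o *:%R a)) => b z /=.
  transitivity (ind_assoc1 x (tens (a * b : right_ext phi) z)); last first.
    by congr (ind_assoc1 x _); apply/esym/ind_scale_tens.
  rewrite !ind_assoc1E; congr tens; exact: (scalerA (b : A^c) (a : A^c) x).
Qed.
(** The associativity map $X \otimes_A (A \otimes_S F) \to X \otimes_S F$ sending $x \otimes (a
    \otimes z)$ to $xa \otimes z$. It is built in two stages, [ind_assoc1] treating a fixed $x$. *)
Definition ind_assoc : tensor X (induction phi F) -> tensor resX F :=
  tens_lift ind_assoc2_balanced.
HB.instance Definition _ := GRing.Additive.on ind_assoc.

Fact ind_coassoc_balanced :
  balanced (fun (x : resX) z => tens (x : X) (ind_unit phi F z : induction phi F)).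
Proof.
split=> [x y z|x y z|s x z].
- exact: tensDl.
- by rewrite linearD; apply: tensDr.
- by rewrite linearZ; apply: tensZ.
Qed.
Definition ind_coassoc : tensor resX F -> tensor X (induction phi F) :=
  tens_lift ind_coassoc_balanced.
HB.instance Definition _ := GRing.Additive.on ind_coassoc.

Lemma ind_assocK : cancel ind_assoc ind_coassoc.
Proof.
apply: (@tens_ext _ _ _ _ (ind_coassoc \o ind_assoc) idfun) => x t /=.
pose tx : {additive induction phi F -> tensor X (induction phi F)} :=
  HB.pack (tens x) (GRing.isZmodMorphism.Build _ _ (tens x : induction phi F -> _)
    (@tensBr _ _ _ x)).
rewrite /ind_assoc tens_liftE; move: t.
apply: (@ind_ext _ _ _ _ _ (ind_coassoc \o ind_assoc1 x) tx) => a z /=.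
rewrite ind_assoc1E /ind_coassoc tens_liftE -[LHS]/(tens ((a : A^c) *: x) _) tensZ.
congr tens; apply: etrans (ind_scale_tens _ _ _) _; by rewrite mulr1.
Qed.
End IndFlat.

Lemma ind_assoc_map (F : lmodType S) (X X' : lmodType A^c) (i : {linear X -> X'}) t :
  ind_assoc (tens_map i (idfun : induction phi F -> induction phi F) t) =
  tens_map (res_map (conv_rmorphism phi) i) (idfun : F -> F) (ind_assoc t).
Proof.
pose tF : {additive _ -> _} :=
  tens_map (res_map (conv_rmorphism phi) i) (idfun : F -> F).
rewrite -[RHS]/(tF _).
move: t; apply: (@tens_ext _ _ _ _
  (@ind_assoc F X' \o tens_map i (idfun : induction phi F -> induction phi F))
  (tF \o @ind_assoc F X)).
move=> x t; rewrite /= tens_mapE /ind_assoc !tens_liftE; move: t.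
apply: (@ind_ext _ _ _ _ _ (ind_assoc1 (i x)) (tF \o ind_assoc1 x)) => a z /=.
by rewrite !ind_assoc1E /tF tens_mapE; congr tens; apply/esym/linearZ.
Qed.

(** Since [ind_assoc] is injective and natural in [X], tensoring [i] with the induced module reduces
    to tensoring the restriction of [i] with [F]. *)
Lemma ind_flat (F : lmodType S) : flat F -> flat (induction phi F).
Proof.
move=> F_flat X X' i i_inj t u iE; apply: (can_inj (@ind_assocK F X)).
apply: (F_flat _ _ (res_map (conv_rmorphism phi) i) i_inj).
by rewrite -!ind_assoc_map iE.
Qed.

End Frobenius.

(** * Flatness of restricted modules *)

Section ResFlat.
Variables (S A : pzRingType) (phi : {rmorphism S -> A}) (fs : frobenius_system phi).
Local Notation phic := (conv_rmorphism phi).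
Variables (F : lmodType A).
Local Notation resF := (restriction phi F).

Section Maps.
Variable (X : lmodType S^c).
Fact res_assoc_balanced :
  balanced (fun (x : X) (z : resF) => tens (ind_unit phic X x : induction phic X) (z : F)).
Proof.
split=> [x y z|x z w|s x z].
- by rewrite linearD; apply: tensDl.
- exact: tensDr.
- by rewrite linearZ; apply: (@tensZ A _ _ (phi s)).
Qed.
(** The map $X \otimes_S F \to (X \otimes_S A) \otimes_A F$ sending $x \otimes z$ to $(x \otimes 1)
    \otimes z$. The right module $X \otimes_S A$ is encoded as induction along [phic], so its two
    factors appear in reverse order. *)
Definition res_assoc : tensor X resF -> tensor (induction phic X) F :=
  tens_lift res_assoc_balanced.
HB.instance Definition _ := GRing.Additive.on res_assoc.

Section Fixed.
Variable z : F.
Fact res_coassoc_balanced :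
  balanced (fun (a : right_ext phic) (x : X) => tens x ((a : A) *: z : resF)).
Proof.
split=> [a b x|a x y|s a x].
- by rewrite -tensDr; congr tens; apply: (scalerDl z (a : A)).
- exact: tensDl.
- by rewrite (@tensZ S _ _ s); congr tens; apply/esym/(scalerA (phi s)).
Qed.
Definition res_coassoc1 : induction phic X -> tensor X resF :=
  tens_lift res_coassoc_balanced.
HB.instance Definition _ := GRing.Additive.on res_coassoc1.
Lemma res_coassoc1E (a : right_ext phic) x :
  res_coassoc1 (tens a x) = tens x ((a : A) *: z : resF).
Proof. exact: tens_liftE. Qed.
End Fixed.

Fact res_coassoc2_balanced :
  balanced (fun (t : induction phic X) (z : F) => res_coassoc1 z t).
Proof.
split=> [t u z|t z w|a t z].
- exact: raddfD.
- pose f : {additive induction phic X -> tensor X resF} :=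
    res_coassoc1 z \+ res_coassoc1 w.
  move: t; apply: (@ind_ext _ _ _ _ _ (res_coassoc1 (z + w)) f) => a x.
  rewrite -[f _]/(res_coassoc1 z _ + res_coassoc1 w _) !res_coassoc1E -tensDr.
  apply: etrans (res_coassoc1E _ _ _) _.
  congr tens; exact: (scalerDr (a : A) z w).
- move: t; apply: (@ind_ext _ _ _ _ _ (res_coassoc1 z \o *:%R (a : A^c)) (res_coassoc1 _)).
  move=> b x /=.
  transitivity (res_coassoc1 z (tens ((a : A^c) * b : right_ext phic) x)).
    by congr (res_coassoc1 z _); apply/ind_scale_tens.
  rewrite !res_coassoc1E; congr tens; exact/esym/(scalerA (b : A) (a : A) z).
Qed.
Definition res_coassoc : tensor (induction phic X) F -> tensor X resF :=
  tens_lift res_coassoc2_balanced.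
HB.instance Definition _ := GRing.Additive.on res_coassoc.

Lemma res_assocK : cancel res_assoc res_coassoc.
Proof.
apply: (@tens_ext _ _ _ _ (res_coassoc \o res_assoc) idfun) => x z /=.
rewrite /res_assoc tens_liftE /res_coassoc tens_liftE res_coassoc1E.
by congr tens; exact: (scale1r (z : F)).
Qed.
End Maps.

Lemma res_assoc_map (X X' : lmodType S^c) (i : {linear X -> X'}) t :
  res_assoc (tens_map i (idfun : resF -> resF) t) =
  tens_map (ind_map phic i) (idfun : F -> F) (res_assoc t).
Proof.
pose tF : {additive _ -> _} := tens_map (ind_map phic i) (idfun : F -> F).
rewrite -[RHS]/(tF _).
move: t; apply: (@tens_ext _ _ _ _
  (@res_assoc X' \o tens_map i (idfun : resF -> resF)) (tF \o @res_assoc X)).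
move=> x z; rewrite /= tens_mapE /res_assoc !tens_liftE /tF tens_mapE.
by congr tens; apply/esym/ind_mapE.
Qed.

(** The converse Frobenius system makes [ind_map phic i] injective; flatness of [F] over [A] then
    applies, and [res_assoc] brings the conclusion back to [S]. *)
Lemma res_flat : flat F -> flat resF.
Proof.
move=> F_flat X X' i i_inj t u iE; apply: (can_inj (@res_assocK X)).
apply: (F_flat _ _ (ind_map phic i) (ind_map_inj (conv_frobenius fs) i_inj)).
by rewrite -!res_assoc_map iE.
Qed.
End ResFlat.

(** * Transport of resolutions and of flat dimension bounds *)

Section Resolutions.
Variables (S A : pzRingType) (phi : {rmorphism S -> A}) (fs : frobenius_system phi).

Definition ind_resolution (F : lmodType S) (P : resolution F) :
  resolution (induction phi F) :=
  @Resolution A (induction phi F) (fun k => induction phi (P k))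
    (fun k => ind_map phi (res_d P k)) (ind_map phi (res_aug P))
    (ind_map_surj fs (@res_aug_surj _ _ P))
    (ind_map_exact fs (@res_exact0 _ _ P))
    (fun k => ind_map_exact fs (@res_exactS _ _ P k)).

Definition res_resolution (F : lmodType A) (P : resolution F) :
  resolution (restriction phi F) :=
  @Resolution S (restriction phi F) (fun k => restriction phi (P k))
    (fun k => res_map phi (res_d P k)) (res_map phi (res_aug P))
    (@res_aug_surj _ _ P) (@res_exact0 _ _ P) (@res_exactS _ _ P).

Lemma ind_flat_dim_le n (F : lmodType S) :
  flat_dim_le n F -> flat_dim_le n (induction phi F).
Proof.
case=> P [P_flat P0]; exists (ind_resolution P); split=> [k|k kn].
  exact/ind_flat/P_flat.
apply: (@ind_ext _ _ _ _ _ idfun \0) => a x /=.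
by rewrite (P0 k kn x); apply: tens0r.
Qed.

Lemma res_flat_dim_le n (F : lmodType A) :
  flat_dim_le n F -> flat_dim_le n (restriction phi F).
Proof.
case=> P [P_flat P0]; exists (res_resolution P); split=> [k|//].
exact/(res_flat fs)/P_flat.
Qed.
End Resolutions.

(** * Vanishing of Ext and transfer of cotorsion bounds *)

(** Unfolds the quotient: in positive degree, vanishing says that each cocycle has a primitive. *)
Lemma Ext_succ_eq0P (A : pzRingType) (F M : lmodType A) (P : resolution F) k :
  (forall x : Ext P M k.+1, x = 0) <->
  (forall f : {linear P k.+1 -> M}, (forall x, f (res_d P k.+1 x) = 0) ->
     exists g : {linear P k -> M}, forall x, f x = g (res_d P k x)).
Proof.
split=> [E0 f f0|E0].
  have fc : (f : P k.+1 -> M) \in @cocycles A F P M k.+1.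
    by apply/asboolP; split=> //; exact: linearP.
  pose c : cocycle P M k.+1 := Sub (f : _ -> _) fc.
  have /eqP : \pi_(Ext P M k.+1) c = \pi_(Ext P M k.+1) 0 by apply: etrans (E0 _) (esym (E0 _)).
  rewrite -Quotient.idealrBE subr0 => /asboolP.
  by rewrite /is_coboundary /= => -[g gE]; exists g.
elim/quotW => c; have /asboolP[cl c0] := valP c.
have [g gE] := E0 (linear_of cl) c0.
have /eqP : c == 0 %[mod Ext P M k.+1]; last by rewrite raddf0.
by rewrite -Quotient.idealrBE subr0; apply/asboolP; exists g.
Qed.

Section CotorsionBound.
Variable n : nat.

(** Push a cocycle forward along [i], take a primitive there, and return along [p]. *)
Lemma cotorsion_bound_retract (A : pzRingType) (M M' : lmodType A) k
    (i : {linear M -> M'}) (p : {linear M' -> M}) :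
  cancel i p -> cotorsion_bound n M' k -> cotorsion_bound n M k.
Proof.
move=> iK bM' F Fn P P_proj; apply/Ext_succ_eq0P => f f0.
have /Ext_succ_eq0P/(_ (i \o f)) := bM' F Fn P P_proj.
case=> [x|g gE]; first by rewrite /= f0 raddf0.
by exists (p \o g) => x; rewrite /= -gE /= iK.
Qed.

Variables (S A : pzRingType) (phi : {rmorphism S -> A}) (fs : frobenius_system phi).

(** The left adjunction on cochains: a cocycle [f] transposes to [ind_lift f] on the induced
    resolution, and a primitive of the latter composed with [ind_unit] is a primitive of [f]. *)
Lemma res_cotorsion_bound (N : lmodType A) k :
  cotorsion_bound n N k -> cotorsion_bound n (restriction phi N) k.
Proof.
move=> bN F Fn P P_proj; apply/Ext_succ_eq0P => f f0.
have /Ext_succ_eq0P/(_ (ind_lift f)) := bN _ (ind_flat_dim_le fs Fn)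
  (ind_resolution fs P) (fun j => ind_projective (P_proj j)).
case=> [|g gE].
  apply: (@ind_ext _ _ _ _ _ (ind_lift f \o ind_map phi (res_d P k.+1)) \0) => a x /=.
  by rewrite ind_mapE ind_liftE f0; apply: (@scaler0 A).
exists (linear_of (linearP (res_map phi g \o ind_unit phi (P k)))) => x.
have := gE (ind_unit phi (P k.+1) x).
rewrite [ind_lift f _]ind_liftE scale1r => ->.
by congr (g _); apply: ind_mapE.
Qed.

(* A cocycle [f] with values in the induced module is the colift of its
   projection to [M]; so a primitive of the projection lifts to one of [f]. *)
Lemma ind_cotorsion_bound (M : lmodType S) k :
  cotorsion_bound n M k -> cotorsion_bound n (induction phi M) k.
Proof.
move=> bM F Fn P P_proj; apply/Ext_succ_eq0P => f f0.
pose f' := linear_of (linearP (ind_proj fs M \o res_map phi f)).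
have /Ext_succ_eq0P/(_ f') := bM _ (res_flat_dim_le fs Fn)
  (res_resolution phi P) (fun j => res_projective fs (P_proj j)).
case=> [x|g gE].
  have f'E : f' (res_d P k.+1 x) = ind_proj fs M (f (res_d P k.+1 x)) by [].
  by apply: etrans f'E _; rewrite f0 linear0.
exists (ind_colift fs g) => x; rewrite -[LHS](ind_sum fs).
apply: eq_bigr => i _; congr tens; rewrite -linearZZ.
apply: etrans (gE _) _; congr (g _); exact: (linearZZ (res_d P k)).
Qed.

(** When the projection fixes [1], [ind_proj] splits the unit, so [M] is a direct summand of its
    induced module restricted back to [S]. *)
Lemma cotorsion_bound_ind (M : lmodType S) k : fpi fs 1 = 1 ->
  cotorsion_bound n (induction phi M) k -> cotorsion_bound n M k.
Proof.
move=> pi1 /res_cotorsion_bound; apply: (@cotorsion_bound_retract _ _ _ _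
  (ind_unit phi M) (ind_proj fs M)) => x.
by rewrite [LHS]ind_projE pi1 scale1r.
Qed.

Section Separable.
Variable N : lmodType A.
Local Notation resN := (restriction phi N).

Fact orbit_linear (v : N) : linear ((fun b => (b : A) *: v) : restriction phi A^o -> resN).
Proof.
move=> s a b; have := scalerDl v (phi s * (a : A)) (b : A).
by rewrite -scalerA; apply.
Qed.
Definition orbit_map (v : N) := linear_of (orbit_linear v).

(** Writing [sigma 1] as $\sum_j a_j \otimes b_j$, the map $i(v) = \sum_j a_j \otimes b_j v$ embeds
    [N] in the module induced from [resN]; the action map $a \otimes v \mapsto av$ splits it since
    $\sum_j a_j b_j = 1$. *)
Lemma cotorsion_bound_res k : separable_extension phi ->
  cotorsion_bound n resN k -> cotorsion_bound n N k.
Proof.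
case=> sigma [sigmaZl sigmaZr sigmaK] /ind_cotorsion_bound.
pose i (v : N) : induction phi resN := ind_map phi (orbit_map v) (sigma 1).
have i_linear : linear i.
  move=> a v w; transitivity (i (a *: v) + i w).
    rewrite /i; move: (sigma 1).
    apply: (@ind_ext _ _ _ _ _ (ind_map phi (orbit_map (a *: v + w)))
      (ind_map phi (orbit_map (a *: v)) \+ ind_map phi (orbit_map w))) => b c.
    apply: etrans (ind_mapE _ _ _) _; symmetry.
    apply: etrans (congr2 +%R (ind_mapE _ _ _) (ind_mapE _ _ _)) _.
    apply: etrans (esym (tensDr _ _ _)) _; congr tens.
    exact/esym/(scalerDr (c : A) (a *: v) w).
  (* Both bimodule laws for [sigma] enter: [a *: sigma 1] is [sigma a], which is [sigma 1]
     multiplied by [a] on the right, and that [a] is then absorbed by [v]. *)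
  congr (_ + _); rewrite /i -linearZZ -sigmaZl mulr1.
  rewrite -[in RHS](mul1r a) sigmaZr; move: (sigma 1).
  apply: (@ind_ext _ _ _ _ _ (ind_map phi (orbit_map (a *: v)))
    (ind_map phi (orbit_map v) \o
     tens_map (idfun : right_ext phi -> _) (square_rmul_fun a))) => b c /=.
  rewrite tens_mapE !ind_mapE; congr tens.
  exact: (scalerA (c : A) a v).
pose idl : {linear resN -> restriction phi N} := idfun.
apply: (@cotorsion_bound_retract _ _ _ _ (linear_of i_linear) (ind_lift idl)) => v.
have K t : ind_lift idl (ind_map phi (orbit_map v) t) = square_mult t *: v.
  elim/tens_ind: t => [b c|t u ht hu].
    rewrite ind_mapE ind_liftE /square_mult tens_liftE.
    exact: (scalerA b (c : A) v).
  rewrite -[t - u]/((t : induction phi _) - u) !linearB ht hu -scalerBl.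
  by congr (_ *: v); apply/esym/(raddfB (tens_lift (square_mult_balanced phi))).
by rewrite [LHS]K sigmaK scale1r.
Qed.
End Separable.
End CotorsionBound.

(** If [N] has no bound the right side is [+oo]; otherwise its least bound also bounds [M]. The two
    modules may live over different rings. *)
Lemma nCtd_le (A B : pzRingType) n (M : lmodType A) (N : lmodType B) :
  (forall k, cotorsion_bound n N k -> cotorsion_bound n M k) ->
  (nCtd n M <= nCtd n N)%E.
Proof.
move=> NM; rewrite /nCtd; case: (pselect (exists k, `[< cotorsion_bound n N k >])) => [exN|_]; last exact: leey.
case: pselect => [exM|[]]; last first.
  by case: exN => k /asboolP/NM/asboolP kM; exists k.
case: ex_minnP => k _ kmin; case: ex_minnP => l /asboolP/NM/asboolP lM _.
by rewrite lee_fin lez_nat kmin.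
Qed.

(** * The Frobenius system of a skew group ring over that of a subgroup *)

Section SkewGroupRing.
Variables (gT : finGroupType) (R : pzRingType) (alpha : ring_action gT R).
Variable H : {group gT}.
Local Notation RG := (skew_group_ring alpha).
Local Notation RH := (skew_group_ring (restr_action alpha H)).
Local Notation incl := (@skew_incl gT R alpha H).

Definition skew_proj (u : RG) : RH := [ffun h => u (sgval h)].

Lemma skew_projE u h : skew_proj u h = u (sgval h).
Proof. exact: ffunE. Qed.

Fact skew_proj_zmod_morphism : {morph skew_proj : u v / u - v}.
Proof. by move=> u v; apply/ffunP => h; rewrite !ffunE. Qed.
HB.instance Definition _ :=
  GRing.isZmodMorphism.Build _ _ skew_proj skew_proj_zmod_morphism.

Lemma skew_projK : cancel incl skew_proj.
Proof. by move=> u; apply/ffunP => h; rewrite !ffunE subgP sgvalK. Qed.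

Lemma skew_inclE u x : incl u x = if x \in H then u (subg H x) else 0.
Proof. exact: ffunE. Qed.

Lemma skew_incl_projE u x : incl (skew_proj u) x = if x \in H then u x else 0.
Proof. by rewrite skew_inclE skew_projE; case: ifP => // xH; rewrite subgK. Qed.

(** Compare coefficients at [x] after the injective [incl]: for [g] in [H], the element $g^{-1}x$
    lies in [H] exactly when [x] does, so the same terms survive on both sides. *)
Lemma skew_projZl s u : skew_proj (incl s * u) = s * skew_proj u.
Proof.
apply: (@skew_incl_inj _ _ alpha H); apply/ffunP => x.
rewrite rmorphM skew_incl_projE !skew_mulE.
case: ifP => xH; last rewrite big1 // => g _.
  apply: eq_bigr => g _; rewrite skew_incl_projE skew_inclE.
  case: ifP => gH; last by rewrite !mul0r.
  by rewrite groupMl ?groupV // xH.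
rewrite skew_incl_projE skew_inclE.
case: ifP => gH; last by rewrite !mul0r.
by rewrite groupMl ?groupV // xH raddf0 mulr0.
Qed.

Lemma skew_projZr u s : skew_proj (u * incl s) = skew_proj u * s.
Proof.
apply: (@skew_incl_inj _ _ alpha H); apply/ffunP => x.
rewrite rmorphM skew_incl_projE !skew_mulE.
case: ifP => xH; last rewrite big1 // => g _.
  apply: eq_bigr => g _; rewrite skew_incl_projE skew_inclE groupMr // groupV.
  by case: ifP => gH //; rewrite raddf0 !mulr0.
rewrite skew_incl_projE skew_inclE.
case: ifP => gH; last by rewrite !mul0r.
by rewrite groupMl ?groupV // xH raddf0 mulr0.
Qed.

(* [lcoset_rep] selects one element [g] in each left coset of [H]; then
   [g^-1] runs over representatives of the right cosets. *)
Local Notation lcoset_rep := {g : gT | repr (g *: H)%g == g}.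

(** The element [repr (x *: H)] lies in [x *: H], hence spans the same coset and is its own selected
    representative. *)
Lemma lcoset_rep_unique x : exists2 t : lcoset_rep, (x \in val t *: H)%g &
  forall t' : lcoset_rep, (x \in val t' *: H)%g -> t' = t.
Proof.
have rE : (repr (x *: H) *: H = x *: H)%g 
  by apply/lcoset_eqP; apply: (mem_repr x); apply: lcoset_refl.
have rP : repr (repr (x *: H) *: H)%g == repr (x *: H)%g by rewrite rE.
exists (exist (fun g : gT => repr (g *: H)%g == g) _ rP) => [|t'].
  by rewrite /= rE lcoset_refl.
by move/lcoset_eqP => xt; apply: val_inj; rewrite /= xt (eqP (valP t')).
Qed.

(** The left cosets partition the group, so one term survives. Rewriting a coefficient as this sum
    lets both dual basis identities be checked term by term. *)
Lemma sum_lcoset_rep (a : R) x :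
  \sum_(t : lcoset_rep) (if (x \in val t *: H)%g then a else 0) = a.
Proof.
have [t xt t_uniq] := lcoset_rep_unique x.
rewrite (bigD1 t) //= xt big1 ?addr0 // => t' /eqP t'Nt.
by case: ifP => // /t_uniq.
Qed.

Lemma skew_basis_mulE (u : RG) a g x :
  (skew_basis alpha a g * u) x = a * alpha g (u (g^-1 * x)%g).
Proof.
rewrite skew_mulE (bigD1 g) //= big1 ?addr0 => [|k kNg].
  by rewrite ffunE eqxx.
by rewrite ffunE (negPf kNg) mul0r.
Qed.

Lemma skew_mul_basisE (u : RG) g x :
  (u * skew_basis alpha 1 g) x = u (x * g^-1)%g.
Proof.
rewrite skew_mulE (bigD1 (x * g^-1)%g) //= big1 ?addr0 => [|k kN].
  by rewrite ffunE invMg invgK mulgKV eqxx rmorph1 mulr1.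
rewrite ffunE; case: eqP => [kg|_]; last by rewrite raddf0 mulr0.
by case/eqP: kN; rewrite -kg invMg invgK mulKVg.
Qed.

Lemma skew_sum_r (u : RG) :
  \sum_(t : lcoset_rep) skew_basis alpha 1 (val t) *
    incl (skew_proj (skew_basis alpha 1 (val t)^-1%g * u)) = u.
Proof.
apply/ffunP => x; rewrite sum_ffunE -[RHS](sum_lcoset_rep _ x).
apply: eq_bigr => t _; rewrite skew_basis_mulE skew_incl_projE mem_lcoset mul1r.
case: ifP => _; last exact: raddf0.
by rewrite skew_basis_mulE mul1r -ractM mulgV ract1 invgK mulKVg.
Qed.

Lemma skew_sum_l (u : RG) :
  \sum_(t : lcoset_rep) incl (skew_proj (u * skew_basis alpha 1 (val t))) *
    skew_basis alpha 1 (val t)^-1%g = u.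
Proof.
(* Here the relevant cosets are the right cosets $Ht^{-1}$, and $x \in Ht^{-1}$ exactly when $x^{-1}
   \in tH$; hence the index is located by the inverse of [x]. *)
apply/ffunP => x; rewrite sum_ffunE -[RHS](sum_lcoset_rep _ x^-1%g).
apply: eq_bigr => t _; rewrite skew_mul_basisE skew_incl_projE invgK.
rewrite mem_lcoset -invMg groupV.
by case: ifP => // _; rewrite skew_mul_basisE mulgK.
Qed.

Definition skew_frobenius : frobenius_system incl :=
  FrobeniusSystem (fpi := skew_proj) skew_projZl skew_projZr skew_sum_r skew_sum_l.

End SkewGroupRing.

Theorem proposition6p5 (R : pzRingType) (G : finGroupType)
    (alpha : ring_action G R) (H : {group G}) (n : nat)
    (M : lmodType (skew_group_ring (restr_action alpha H)))
    (N : lmodType (skew_group_ring alpha)) :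
  nCtd n M = nCtd n (induction (@skew_incl G R alpha H) M) /\
  ((nCtd n (restriction (@skew_incl G R alpha H) N) <= nCtd n N)%E /\
   (separable_extension (@skew_incl G R alpha H) ->
    nCtd n N = nCtd n (restriction (@skew_incl G R alpha H) N))).
Proof.
pose fs := skew_frobenius alpha H.
(* The projection is a retraction of the inclusion, which sends [1] to [1]. *)
have pi1 : fpi fs 1 = 1 by rewrite -[RHS](@skew_projK _ _ alpha) rmorph1.
have res_le : (nCtd n (restriction (@skew_incl G R alpha H) N) <= nCtd n N)%E.
  by apply: nCtd_le => k; apply: (res_cotorsion_bound fs).
split; last split=> // [sep].
  apply/eqP; rewrite eq_le; apply/andP; split; apply: nCtd_le => k.
    exact: (cotorsion_bound_ind pi1).
  exact: (ind_cotorsion_bound fs).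
apply/eqP; rewrite eq_le res_le andbT; apply: nCtd_le => k.
exact: (cotorsion_bound_res fs sep).
Qed.
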